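(* Let $p$ be a prime, $\alpha \geq 1$, and let $P \in \mathbb{Z}_p[x, y]$ be square-free with $h := \deg_x P \geq 1$ and $d := \deg_y P \geq 1$. Let $F = \sum_{n \geq 0} a(n) x^n \in \mathbb{Z}_p[[x]]$ satisfy $P(x, F) = 0$. Let $e = \mathrm{mindeg}_x(\mathrm{res}_y(P, \frac{\partial P}{\partial y}))$, $V = \sum_{n = 0}^e a(n) x^n$, and $P_e = P(x, V + x^e z) \in \mathbb{Z}_p[x, z]$. Let $s \in \{e, e + 1, \dots, 2e\}$ be the integer such that $P_e / x^s$ is a polynomial satisfying $\frac{\partial (P_e / x^s)}{\partial z}(0, 0) \neq 0$. Suppose that $\frac{\partial (P_e / x^s)}{\partial z}(0, 0) \not\equiv 0 \bmod p$, $\deg_x P_e = \deg_x(P_e \bmod p)$, and $\deg_z P_e = \deg_z(P_e \bmod p)$. Then $|\ker_p((a(n) \bmod p^\alpha)_{n \geq 0})|$ is at most $$(1 + o(1)) \, p^{\frac{1}{6} \alpha (\alpha + 1) ((2 h d (2 d^2 - d + 1) - 1) \alpha + h d (2 d^2 - d + 1) + 1)}$$ as any one of $p$, $\alpha$, $h$, or $d$ tends to infinity and the others remain constant.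
   Context: $\mathbb{Z}_p$ denotes the $p$-adic integers. $\mathrm{res}_y$ is the resultant with respect to $y$; square-freeness of $P$ is assumed so that $\mathrm{res}_y(P, \frac{\partial P}{\partial y}) \neq 0$. $\mathrm{mindeg}_x$ denotes the smallest exponent of $x$ occurring with a nonzero coefficient. An integer $s \in \{e, \dots, 2e\}$ as in the claim always exists, and it is unique (it is the $\mathrm{mindeg}_x$ of the coefficient of $z^1$ in $P_e$). The $p$-kernel of a sequence $b(n)_{n \geq 0}$ is $\ker_p(b(n)_{n \geq 0}) = \{b(p^i n + r)_{n \geq 0} : i \geq 0,\ 0 \leq r \leq p^i - 1\}$. Asymptotic convention: the bound is uniform in the data. That is, let $K(p, \alpha, h, d)$ be the maximum of the kernel size over all pairs $(P, F)$ satisfying the hypotheses with the given $p, \alpha, h, d$, and let $N$ be the displayed exponent of $p$. The claim is that $\limsup K(p, \alpha, h, d)/p^N \leq 1$ as one of the four parameters tends to infinity while the other three are fixed. *)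

(* Defs.v *)
From HB Require Import structures.
From mathcomp Require Import all_boot all_order all_algebra.
From mathcomp Require Import all_classical all_reals all_analysis.

Set Implicit Arguments.
Unset Strict Implicit.
Unset Printing Implicit Defensive.

Import Order.TTheory GRing.Theory Num.Theory.

Local Open Scope ring_scope.

(* The ring Z_p as the inverse limit of the rings Z/p^(n+1). Its elements are *)
(* compatible families of residues; [x n] is the residue of x mod p^(n+1).    *)
(* Levels start at p^1 because 'Z_1 is not Z/1 but Z/2. For the same reason   *)
(* the construction yields junk nonzero rings when p is 0 or 1.               *)

Section PadicInt.
Variable p : nat.

Definition Zp_restr n (x : 'Z_(p ^ n.+2)) : 'Z_(p ^ n.+1) := (x : nat)%:R.

Record padic_int := PadicInt {
  padic_res :> forall n, 'Z_(p ^ n.+1);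
  padic_resP : forall n, Zp_restr (padic_res n.+1) = padic_res n }.

Lemma padic_ext (x y : padic_int) : (forall n, x n = y n) -> x = y.
Proof.
case: x y => [x Px] [y Py] /= eq_xy.
have {}eq_xy : x = y by apply: functional_extensionality_dep.
by subst y; congr PadicInt; exact: Prop_irrelevance.
Qed.

HB.instance Definition _ := gen_eqMixin padic_int.
HB.instance Definition _ := gen_choiceMixin padic_int.

Lemma Zp_restr_nat n (m : nat) :
  Zp_restr (m%:R : 'Z_(p ^ n.+2)) = m%:R.
Proof.
apply: val_inj; rewrite /Zp_restr !Zp_nat /= modn_dvdm //.
have [p_gt1|] := ltnP 1 p.
  have pX_gt1 k : (1 < p ^ k.+1)%N by rewrite -(exp1n k.+1) ltn_exp2r.
  by rewrite !Zp_cast ?dvdn_exp2l.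
by case: p => [|[|//]] _; rewrite ?exp0n ?exp1n.
Qed.

Lemma Zp_restr0 n : Zp_restr (0 : 'Z_(p ^ n.+2)) = 0.
Proof. exact: (Zp_restr_nat n 0). Qed.

Lemma Zp_restr1 n : Zp_restr (1 : 'Z_(p ^ n.+2)) = 1.
Proof. exact: (Zp_restr_nat n 1). Qed.

Lemma Zp_restrD n (x y : 'Z_(p ^ n.+2)) :
  Zp_restr (x + y) = Zp_restr x + Zp_restr y.
Proof. by rewrite -[x]natr_Zp -[y]natr_Zp -natrD !Zp_restr_nat natrD. Qed.

Lemma Zp_restrM n (x y : 'Z_(p ^ n.+2)) :
  Zp_restr (x * y) = Zp_restr x * Zp_restr y.
Proof. by rewrite -[x]natr_Zp -[y]natr_Zp -natrM !Zp_restr_nat natrM. Qed.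

Lemma Zp_restrN n (x : 'Z_(p ^ n.+2)) : Zp_restr (- x) = - Zp_restr x.
Proof. by apply/eqP; rewrite -addr_eq0 -Zp_restrD addNr Zp_restr0. Qed.

Definition padic_zero := @PadicInt (fun=> 0) Zp_restr0.
Definition padic_one := @PadicInt (fun=> 1) Zp_restr1.

Definition padic_opp (x : padic_int) : padic_int.
Proof.
exists (fun n => - x n) => n; abstract by rewrite Zp_restrN padic_resP.
Defined.

Definition padic_add (x y : padic_int) : padic_int.
Proof.
exists (fun n => x n + y n) => n; abstract by rewrite Zp_restrD !padic_resP.
Defined.

Definition padic_mul (x y : padic_int) : padic_int.
Proof.
exists (fun n => x n * y n) => n; abstract by rewrite Zp_restrM !padic_resP.
Defined.

Fact padic_addA : associative padic_add.
Proof. by move=> x y z; apply: padic_ext => n; apply: addrA. Qed.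
Fact padic_addC : commutative padic_add.
Proof. by move=> x y; apply: padic_ext => n; apply: addrC. Qed.
Fact padic_add0 : left_id padic_zero padic_add.
Proof. by move=> x; apply: padic_ext => n; apply: add0r. Qed.
Fact padic_addN : left_inverse padic_zero padic_opp padic_add.
Proof. by move=> x; apply: padic_ext => n; apply: addNr. Qed.
HB.instance Definition _ := GRing.isZmodule.Build padic_int
  padic_addA padic_addC padic_add0 padic_addN.

Fact padic_mulA : associative padic_mul.
Proof. by move=> x y z; apply: padic_ext => n; apply: mulrA. Qed.
Fact padic_mulC : commutative padic_mul.
Proof. by move=> x y; apply: padic_ext => n; apply: mulrC. Qed.
Fact padic_mul1 : left_id padic_one padic_mul.
Proof. by move=> x; apply: padic_ext => n; apply: mul1r. Qed.
Fact padic_mulD : left_distributive padic_mul padic_add.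
Proof. by move=> x y z; apply: padic_ext => n; apply: mulrDl. Qed.
Fact padic_one_neq0 : padic_one != padic_zero.
Proof.
by apply/eqP => /(congr1 (fun x : padic_int => x 0)) /eqP; rewrite oner_eq0.
Qed.
HB.instance Definition _ := GRing.Zmodule_isComNzRing.Build padic_int
  padic_mulA padic_mulC padic_mul1 padic_mulD padic_one_neq0.

(* Reduction mod p^k, meaningful for k >= 1. *)
Definition padic_mod k (x : padic_int) : 'Z_(p ^ k) := (x k.-1 : nat)%:R.

(* Coefficientwise reduction mod p. *)
Definition polyXY_modp (P : {poly {poly padic_int}}) :
  {poly {poly 'Z_(p ^ 1)}} := map_poly (map_poly (padic_mod 1)) P.

End PadicInt.

Section PowerSeries.
Variable R : comNzRingType.

Record powser := Powser { powser_coef :> nat -> R }.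

HB.instance Definition _ := gen_eqMixin powser.
HB.instance Definition _ := gen_choiceMixin powser.

Lemma powser_ext (f g : powser) : (forall n, f n = g n) -> f = g.
Proof. by case: f g => [f] [g] /= /funext ->. Qed.

Definition powser_zero := Powser (fun=> 0).
Definition powser_one := Powser (fun n => (n == 0%N)%:R).
Definition powser_opp (f : powser) := Powser (fun n => - f n).
Definition powser_add (f g : powser) := Powser (fun n => f n + g n).
Definition powser_mul (f g : powser) :=
  Powser (fun n => \sum_(i < n.+1) f i * g (n - i)%N).

Fact powser_addA : associative powser_add.
Proof. by move=> f g h; apply: powser_ext => n; apply: addrA. Qed.
Fact powser_addC : commutative powser_add.
Proof. by move=> f g; apply: powser_ext => n; apply: addrC. Qed.
Fact powser_add0 : left_id powser_zero powser_add.
Proof. by move=> f; apply: powser_ext => n; apply: add0r. Qed.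
Fact powser_addN : left_inverse powser_zero powser_opp powser_add.
Proof. by move=> f; apply: powser_ext => n; apply: addNr. Qed.
HB.instance Definition _ := GRing.isZmodule.Build powser
  powser_addA powser_addC powser_add0 powser_addN.

Definition powser_trunc N (f : powser) : {poly R} := \poly_(i < N) f i.

Lemma powser_mul_trunc N (f g : powser) n : (n < N)%N ->
  powser_mul f g n = (powser_trunc N f * powser_trunc N g)`_n.
Proof.
move=> ltnN; rewrite coefM; apply: eq_bigr => i _; rewrite !coef_poly.
by rewrite (leq_ltn_trans (leq_subr _ _) ltnN) (leq_ltn_trans _ ltnN) ?leq_ord.
Qed.

Fact powser_mulC : commutative powser_mul.
Proof.
by move=> f g; apply: powser_ext => n; rewrite !(powser_mul_trunc _ _ (ltnSn n)) mulrC.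
Qed.

Fact powser_mulA : associative powser_mul.
Proof.
move=> f g h; apply: powser_ext => n.
transitivity (powser_trunc n.+1 f * (powser_trunc n.+1 g * powser_trunc n.+1 h))`_n.
  rewrite coefM; apply: eq_bigr => i _; rewrite coef_poly ltn_ord.
  by rewrite -powser_mul_trunc // ltnS leq_subr.
rewrite mulrA coefM; apply: eq_bigr => i _.
by rewrite -powser_mul_trunc ?ltn_ord // coef_poly ltnS leq_subr.
Qed.

Fact powser_mul1 : left_id powser_one powser_mul.
Proof.
move=> f; apply: powser_ext => n; rewrite /= big_ord_recl /= mul1r subn0.
by rewrite big1 ?addr0 // => i _; rewrite mul0r.
Qed.

Fact powser_mulD : left_distributive powser_mul powser_add.
Proof.
move=> f g h; apply: powser_ext => n; rewrite /= -big_split.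
by apply: eq_bigr => i _; rewrite mulrDl.
Qed.

Fact powser_one_neq0 : powser_one != powser_zero.
Proof.
by apply/eqP => /(congr1 (fun f : powser => f 0%N)) /eqP; rewrite oner_eq0.
Qed.
HB.instance Definition _ := GRing.Zmodule_isComNzRing.Build powser
  powser_mulA powser_mulC powser_mul1 powser_mulD powser_one_neq0.

Definition powser_of_poly (q : {poly R}) : powser := Powser (fun n => q`_n).

Fact powser_of_poly_zmod : zmod_morphism powser_of_poly.
Proof. by move=> q r; apply: powser_ext => n; rewrite /= coefB. Qed.
HB.instance Definition _ := GRing.isZmodMorphism.Build {poly R} powser
  powser_of_poly powser_of_poly_zmod.

Fact powser_of_poly_monoid : monoid_morphism powser_of_poly.
Proof.
by split=> [|q r]; apply: powser_ext => n; rewrite /= ?coef1 ?coefM.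
Qed.
HB.instance Definition _ := GRing.isMonoidMorphism.Build {poly R} powser
  powser_of_poly powser_of_poly_monoid.

End PowerSeries.

Definition squarefree (A : comNzRingType) (u : A) : Prop :=
  forall v w, u = v ^+ 2 * w -> exists v', v * v' = 1.

(* An element of R[x, y] is a polynomial in y over R[x]: as in polyXY, the    *)
(* outer indeterminate is y (or z), and [sizeY] is one plus the x-degree.     *)

(* P(x, F) *)
Definition eval_powser (R : comNzRingType) (P : {poly {poly R}})
  (F : powser R) : powser R := (map_poly (@powser_of_poly R) P).[F].

(* The value at 0 is 0. *)
Definition mindeg (R : nzRingType) (q : {poly R}) : nat :=
  find (fun c => c != 0) q.

(* V = \sum_(n <= e) a(n) x^n and P_e = P(x, V + x^e z). *)
Definition shifted_poly (R : comNzRingType) (P : {poly {poly R}})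
    (F : powser R) (e : nat) : {poly {poly R}} :=
  let V : {poly R} := \poly_(n < e.+1) F n in
  P \Po (V%:P + ('X^e)%:P * 'X).

Definition pkernel (T : Type) (p : nat) (b : nat -> T) : set (nat -> T) :=
  [set c | exists i r, (r <= p ^ i - 1)%N /\
                       c = (fun n => b (p ^ i * n + r)%N)].

(* Main.v *)
From HB Require Import structures.
Require Import Defs.
From mathcomp Require Import all_boot all_order all_algebra.
From mathcomp Require Import finmap.
From mathcomp Require Import all_classical all_reals all_analysis.
From mathcomp Require Import zify ring lra.
Import Order.TTheory GRing.Theory Num.Theory numFieldNormedType.Exports.
Local Open Scope classical_set_scope.
Local Open Scope ring_scope.

(* Write Q = P_e / x^s and F = V + x^e Z. In the coordinates x = uz, Q = z W  *)
(* with W a unit of R[[u, z]], R = Z/p^alpha, and Furstenberg's theorem makes *)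
(* F the diagonal of T / W, where T = (V + x^e z) Q_z - d x^e Q; the last     *)
(* term has no diagonal and only lowers the degree. The p-kernel of F is the  *)
(* orbit of T / W under the Cartier operators, and it stays in the set of     *)
(* states sum_(i < alpha) p^i T_i / W^(i+1) with T_i supported in a box       *)
(* growing linearly in i, because W^p = W(u^p, z^p) + p E with E supported    *)
(* in p times the box of W. The carry p T / W^i = p (T W) / W^(i+1) reduces   *)
(* the coefficients of T_i to digits in {0, ..., p - 1}, which bounds the     *)
(* number of states by p to the sum of the box areas. Since e is at most      *)
(* h (2 d - 1) and deg_x Q <= h + d e - s, this is below the claimed bound    *)
(* with o(1) = 0 as soon as s > e; when s = e the root of P(0, y) at a(0) is  *)
(* simple modulo p and the argument applies with e = s = 0.                   *)

(** Every sequence in the kernel is the diagonal of a member of one finite set of fractions, and it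
    suffices to count that set. [furstenberg] writes the root as the diagonal of a numerator times
    [w], the inverse of [W]. Diagonals commute with taking sections along residue classes, so
    [state_orbit] reaches each kernel element by iterating Cartier operators inside the set of
    states. Stability ([state_cartier]) rests on two facts. The projection formula [pscartierM]
    pulls Frobenius images out of an operator. By [frobenius_defect], W^p is a Frobenius image up to
    a multiple of p; trading W^p for that image leaves an error with a higher denominator but one
    more factor p, so the process ends at p^alpha = 0. The supports scale with the denominators, and
    the operator divides them by p again. [state_cover] counts the states through base-p digits, and
    [padic_kernel_cover] transfers the count to the p-adic root. [mindeg_discr_le] bounds e by the
    Sylvester determinant, and [sum_boxes_le] compares exponents. If s = e, [shifted_deriv00] shows
    that the root is already simple at x = 0 modulo p. *)

Set Implicit Arguments.
Unset Strict Implicit.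
Unset Printing Implicit Defensive.

(** * Power series *)

Section PowserTheory.
Variable A : comNzRingType.
Implicit Types (f g h : powser A) (n m : nat) (c : A).

Lemma coef_psD f g n : (f + g) n = f n + g n. Proof. by []. Qed.
Lemma coef_psN f n : (- f) n = - f n. Proof. by []. Qed.
Lemma coef_psB f g n : (f - g) n = f n - g n. Proof. by []. Qed.
Lemma coef_ps0 n : (0 : powser A) n = 0. Proof. by []. Qed.
Lemma coef_ps1 n : (1 : powser A) n = (n == 0%N)%:R. Proof. by []. Qed.
Lemma coef_psM f g n : (f * g) n = \sum_(i < n.+1) f i * g (n - i)%N.
Proof. by []. Qed.

Lemma coef_psM0 f g : (f * g) 0%N = f 0%N * g 0%N.
Proof. by rewrite coef_psM big_ord1. Qed.

Lemma coef_psMn f m n : (f *+ m) n = f n *+ m.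
Proof. by elim: m => [|m IH]; rewrite ?mulr0n // !mulrS coef_psD IH. Qed.

Lemma coef_ps_sum I (r : seq I) (P : pred I) (F : I -> powser A) n :
  (\sum_(i <- r | P i) F i) n = \sum_(i <- r | P i) F i n.
Proof. by elim/big_rec2: _ => // i y x _ <-. Qed.

Definition powserX : powser A := Powser (fun n => (n == 1%N)%:R).
Definition powserC c : powser A := Powser (fun n => c *+ (n == 0%N)).

Lemma coef_psCM c f n : (powserC c * f) n = c * f n.
Proof.
rewrite coef_psM big_ord_recl subn0 big1 ?addr0 // => i _.
by rewrite mul0r.
Qed.

Lemma coef_psXM f n : (powserX * f) n = if n is m.+1 then f m else 0.
Proof.
case: n => [|n]; first by rewrite coef_psM0 mul0r.
rewrite coef_psM 2!big_ord_recl /= mul0r mul1r add0r subSS subn0 big1 ?addr0 //.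
by move=> i _; rewrite mul0r.
Qed.

Lemma coef_psXnM f m n :
  (powserX ^+ m * f) n = if (m <= n)%N then f (n - m)%N else 0.
Proof.
elim: m n => [|m IH] n; first by rewrite mul1r subn0.
by rewrite exprS -mulrA coef_psXM; case: n => // n; rewrite IH.
Qed.

Lemma eq_coef_psM f g h (k : powser A) n :
    (forall i, (i <= n)%N -> f i = h i) -> (forall i, (i <= n)%N -> g i =
      k i) ->
  (f * g) n = (h * k) n.
Proof.
move=> eq_f eq_g; apply: eq_bigr => i _.
by rewrite eq_f ?leq_ord // eq_g // leq_subr.
Qed.

Lemma coef_ps_exp_small h m n : h 0%N = 0 -> (n < m)%N -> (h ^+ m) n = 0.
Proof.
move=> h0; elim: m n => // m IH n; rewrite ltnS => le_nm.
rewrite exprS coef_psM big_ord_recl h0 mul0r add0r big1 // => i _.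
by rewrite IH ?mulr0 // lift0; have := ltn_ord i; lia.
Qed.

(* Geometric series: f = f_0 (1 - h) with h_0 = 0. *)
Lemma powser_inv f c : f 0%N * c = 1 -> exists g, f * g = 1.
Proof.
move=> f0c; pose h : powser A := 1 - powserC c * f.
have h0 : h 0%N = 0 by rewrite coef_psB coef_psCM coef_ps1 [c * _]mulrC f0c
  subrr.
have hE : powserC c * f = 1 - h by rewrite opprB addrC subrK.
move: (h) h0 hE => {}h h0 hE.
pose g : powser A := Powser (fun n => (\sum_(i < n.+1) h ^+ i) n).
exists (powserC c * g); apply: powser_ext => n.
rewrite mulrCA mulrA hE.
rewrite (@eq_coef_psM _ _ (1 - h) (\sum_(i < n.+1) h ^+ i)) //; last first.
  move=> i le_in; rewrite /g /= !coef_ps_sum.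
  rewrite -!(big_mkord xpredT (fun j => (h ^+ j) i)).
  rewrite [RHS](big_cat_nat (n := i.+1)) //=.
  rewrite [X in _ = _ + X]big_nat [X in _ = _ + X]big1 ?addr0 //.
  by move=> j /andP[lt_ij _]; rewrite coef_ps_exp_small.
have -> : (1 - h) * \sum_(i < n.+1) h ^+ i = 1 - h ^+ n.+1.
  by rewrite -[RHS]opprB subrX1 -mulNr opprB.
by rewrite coef_psB coef_ps_exp_small // subr0.
Qed.

Definition ordge m f := forall n, (n < m)%N -> f n = 0.

Lemma ordge_mul m n f g : ordge m f -> ordge n g -> ordge (m + n) (f * g).
Proof.
move=> fm gn k lt_k; apply: big1 => i _.
have [/fm->|le_mi] := ltnP i m; first by rewrite mul0r.
by rewrite gn ?mulr0 //; have := ltn_ord i; lia.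
Qed.

Lemma ordge_sum m I (r : seq I) (P : pred I) (F : I -> powser A) :
  (forall i, P i -> ordge m (F i)) -> ordge m (\sum_(i <- r | P i) F i).
Proof. by move=> Fm n ltnm; rewrite coef_ps_sum big1 // => i /Fm ->. Qed.

End PowserTheory.

Arguments powserX {A}.

(** * Frobenius lifts and Cartier operators on power series in one variable *)

Section Frobenius.
Variable p : nat.
Hypothesis p_pr : prime p.

Definition pmultiple (A : comNzRingType) (x : A) := exists y, x = y *+ p.

Section Pmultiple.
Variable A : comNzRingType.
Implicit Types x y : A.

Lemma pmultiple0 : pmultiple (0 : A). Proof. by exists 0; rewrite mul0rn. Qed.
Lemma pmultipleD x y : pmultiple x -> pmultiple y -> pmultiple (x + y).
Proof. by move=> [a ->] [b ->]; exists (a + b); rewrite mulrnDl. Qed.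
Lemma pmultiple_exprD x y : pmultiple ((x + y) ^+ p - x ^+ p - y ^+ p).
Proof.
have dvd_bin k : (0 < k < p)%N -> (p %| 'C(p, k))%N by apply: prime_dvd_bin.
have := prime_gt0 p_pr; rewrite exprDn /pmultiple;
  case: p dvd_bin => // n dvd_bin _.
rewrite big_ord_recl big_ord_recr /= subn0 !expr0 mulr1 bin0 mulr1n.
rewrite /bump leq0n add1n subnn expr0 mul1r binn mulr1n.
rewrite [x ^+ _ + _]addrC addrK addrK.
elim/big_ind: _ => [||i _].
- by exists 0; rewrite mul0rn.
- by move=> _ _ [a ->] [b ->]; exists (a + b); rewrite mulrnDl.
have /dvdnP[k ->] : (n.+1 %| 'C(n.+1, bump 0 i))%N.
  by apply: dvd_bin; rewrite /bump /= add1n ltnS ltn_ord.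
by exists (x ^+ (n.+1 - (1 + i)) * y ^+ (1 + i) *+ k); rewrite -mulrnA.
Qed.
End Pmultiple.

(** The substitution of x^p for x, twisted by [phi] on coefficients. A general [phi] allows
    iteration: once in z over R, then in u over R[[z]]. *)
Definition psfrob (A : comNzRingType) (phi : A ->
  A) (f : powser A) : powser A :=
  Powser (fun n => if (p %| n)%N then phi (f (n %/ p)%N) else 0).

Lemma pmultiple_powser (A : comNzRingType) (f : powser A) :
  (forall n, pmultiple (f n)) -> pmultiple f.
Proof.
move=> /choice[g fE]; exists (Powser g); apply: powser_ext => n.
by rewrite coef_psMn fE.
Qed.

(** Split f = f_0 + x f_1. Modulo p the p-th power is f_0^p + x^p f_1^p, so the coefficient at n
    reduces to the one at n - p for f_1. *)
Lemma pmultiple_psfrob (A : comNzRingType) (phi : A -> A) :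
    (forall x, pmultiple (x ^+ p - phi x)) ->
  forall f : powser A, pmultiple (f ^+ p - psfrob phi f).
Proof.
move=> phiP f; apply: pmultiple_powser => n; have p_gt0 := prime_gt0 p_pr.
elim/ltn_ind: n f => n IH f; rewrite coef_psB.
pose f1 : powser A := Powser (fun n => f n.+1).
have fE : f = powserC (f 0%N) + powserX * f1.
  apply: powser_ext => k; rewrite coef_psD coef_psXM /=.
  by case: k => [|k]; rewrite ?addr0 ?add0r ?mulr1n.
have Cp c : powserC c ^+ p = powserC (c ^+ p) :> powser A.
  elim: p => [|k IHk]; first by apply: powser_ext => k; rewrite !expr0 /= mulrb.
  by rewrite exprS IHk; apply: powser_ext => j; rewrite coef_psCM exprS mulrnAr.
have [y yE] := pmultiple_exprD (powserC (f 0%N)) (powserX * f1).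
have {yE}-> : f ^+ p = y *+ p + powserC (f 0%N ^+ p) + powserX ^+ p * f1 ^+ p.
  by rewrite [in LHS]fE -yE -Cp -exprMn -[RHS]addrA -[X in _ =
    X + _]addrA -opprD subrK.
rewrite !coef_psD coef_psMn coef_psXnM /=.
rewrite -!addrA; apply: pmultipleD; first by exists (y n).
have [le_pn|lt_np] := leqP p n.
  have -> : (n == 0%N) = false by case: n p_gt0 le_pn {IH} => //; case: (p).
  rewrite add0r; have := IH (n - p)%N _ f1; rewrite coef_psB /=.
  rewrite dvdn_subl // -[in f (n %/ p)%N](subnK le_pn) divnDr // divnn p_gt0
    addn1.
  by apply; lia.
rewrite add0r; case: (posnP n) => [->|n_gt0].
  by rewrite dvdn0 div0n mulr1n.
by rewrite mulr0n add0r gtnNdvd // oppr0; apply: pmultiple0.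
Qed.

Lemma sum_multiples (V : nmodType) (G : nat -> V) n r : (r < p)%N ->
  \sum_(i < (p * n + r).+1) (if (p %| i)%N then G (i %/ p)%N else 0) =
  \sum_(j < n.+1) G j.
Proof.
move=> lt_rp; have p_gt0 := prime_gt0 p_pr.
rewrite -(big_mkord xpredT (fun i => if (p %| i)%N then G (i %/ p)%N else 0)).
rewrite -(big_mkord xpredT G).
elim: n r lt_rp => [|n IH] r lt_rp.
  rewrite muln0 big_nat_recl //= dvdn0 div0n big_nat1 big_nat big1 ?addr0 //.
  by move=> i ltir; rewrite gtnNdvd //; lia.
rewrite (big_cat_nat (n := (p * n + p.-1).+1)) //=; last by lia.
rewrite IH ?prednK // [RHS]big_nat_recr //=; congr (_ + _).
rewrite big_ltn; last by lia.
rewrite -addnS prednK // -mulnSr dvdn_mulr // mulKn // big_nat big1 ?addr0 //.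
move=> i /andP[lt1 lt2]; rewrite -(@subnKC (p * n.+1) i) ?dvdn_addr ?dvdn_mulr
  //.
  by rewrite gtnNdvd //; lia.
exact: ltnW.
Qed.

Section PsfrobMorphism.
Variables (A : comNzRingType) (phi : {rmorphism A -> A}).

Fact psfrob_zmod : zmod_morphism (psfrob phi).
Proof.
move=> f g; apply: powser_ext => n; rewrite !coef_psB /=.
by case: ifP; rewrite ?subrr ?rmorphB.
Qed.

Fact psfrob_monoid : monoid_morphism (psfrob phi).
Proof.
have p_gt0 := prime_gt0 p_pr.
split=> [|f g]; apply: powser_ext => n.
  rewrite /= rmorph_nat; case: n => [|n]; first by rewrite dvdn0 div0n.
  by case: ifP => // /dvdnP[k ->];
    rewrite mulnK // muln_eq0 (gtn_eqF p_gt0) orbF.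
rewrite coef_psM /=; case: ifP => [/dvdnP[k ->]|p_ndvd].
  rewrite mulnK // rmorph_sum.
  rewrite -(@sum_multiples _ (fun j => phi (f j * g (k - j)%N)) k 0) // addn0
    [(k * p)%N]mulnC.
  apply: eq_bigr => i _; case: ifP => [p_i|]; last by rewrite mul0r.
  have le_i : (i <= p * k)%N by rewrite -ltnS.
  rewrite dvdn_subr ?dvdn_mulr // p_i.
  by rewrite divnBr // mulKn // rmorphM.
rewrite big1 // => i _; case: ifP => p_i; last by rewrite mul0r.
have le_in : (i <= n)%N by rewrite -ltnS.
by rewrite -(dvdn_addr _ p_i) subnKC // p_ndvd mulr0.
Qed.
End PsfrobMorphism.

Definition pscartier r (A : comNzRingType) (lam : A ->
  A) (f : powser A) : powser A :=
  Powser (fun n => lam (f (p * n + r)%N)).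

Section Cartier.
Variables (A : comNzRingType) (phi : A -> A) (lam : {additive A ->
  A}) (r : nat).

Fact pscartier_zmod : zmod_morphism (pscartier r lam).
Proof. by move=> f g; apply: powser_ext => n; rewrite /= raddfB. Qed.
HB.instance Definition _ := GRing.isZmodMorphism.Build (powser A) (powser A)
  (pscartier r lam) pscartier_zmod.

(** The projection formula: only the exponents divisible by p survive in the Frobenius image, and
    dividing them by p gives back f. *)
Lemma pscartierM : (r < p)%N -> (forall a b, lam (phi a * b) = a * lam b) ->
  forall f g, pscartier r lam (psfrob phi f * g) = f * pscartier r lam g.
Proof.
move=> lt_rp lamM f g; apply: powser_ext => n; rewrite /= raddf_sum.
rewrite -(@sum_multiples _ (fun j => f j * lam (g (p * (n - j) + r)%N)) n r) //.
apply: eq_bigr => i _ /=; case: ifP => [/dvdnP[k ik]|]; last first.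
  by rewrite mul0r raddf0.
rewrite lamM ik mulnK ?prime_gt0 // mulnBr addnBAC // ?[(p * k)%N]mulnC //.
rewrite [(k * p)%N]mulnC leq_pmul2l ?prime_gt0 // leqNgt; apply/negP => lt_nk.
have := leq_mul (leqnn p) lt_nk; rewrite mulnS.
by have := ltn_ord i; rewrite ik [(k * p)%N]mulnC; lia.
Qed.
End Cartier.
End Frobenius.

(** * Diagonals of bivariate series *)

(* An element of B is a series in u with coefficients in R[[z]]: the variable *)
(* u is powserX, z is psz, and psdelta f is f(uz).                           *)

Section Bivariate.
Variable R : comNzRingType.
Local Notation K := (powser R).
Local Notation B := (powser (powser R)).
Implicit Types (f g : K) (b c : B) (i j k m n : nat).

Definition psmono m (r : R) : K := Powser (fun n => r *+ (n == m)).

Lemma coef_psmonoM m (r : R) g n :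
  (psmono m r * g) n = if (m <= n)%N then r * g (n - m)%N else 0.
Proof.
have -> : psmono m r = powserX ^+ m * powserC r.
  apply: powser_ext => k; rewrite coef_psXnM /= subn_eq0.
  by case: (ltngtP m k); rewrite ?mulr1n ?mulr0n.
by rewrite -mulrA coef_psXnM coef_psCM.
Qed.

Definition psdelta f : B := Powser (fun i => psmono i (f i)).

Lemma coef_psdeltaM f b i j :
  (psdelta f * b) i j =
  \sum_(k < i.+1) (if (k <= j)%N then f k * b (i - k)%N (j - k)%N else 0).
Proof. by rewrite coef_psM coef_ps_sum; apply: eq_bigr => k _;
  rewrite coef_psmonoM. Qed.

Fact psdelta_zmod : zmod_morphism psdelta.
Proof.
move=> f g; apply: powser_ext => i; apply: powser_ext => j.
by rewrite !coef_psB /= mulrnBl.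
Qed.
HB.instance Definition _ := GRing.isZmodMorphism.Build K B psdelta psdelta_zmod.

Fact psdelta_monoid : monoid_morphism psdelta.
Proof.
split=> [|f g]; apply: powser_ext => i; apply: powser_ext => j.
  by rewrite /=; case: i => [|i] //=; rewrite ?mul0rn.
rewrite coef_psdeltaM /= -sumrMnl; apply: eq_bigr => k _.
have := ltn_ord k; rewrite ltnS => le_ki.
case: leqP => [le_kj|lt_jk]; last by rewrite (_ : (j == i) =
  false) ?mulr0n //; lia.
by rewrite -mulrnAr; congr (_ * (_ *+ nat_of_bool _)); lia.
Qed.
HB.instance Definition _ := GRing.isMonoidMorphism.Build K B psdelta
  psdelta_monoid.

Definition diag b : K := Powser (fun n => b n n).

Fact diag_zmod : zmod_morphism diag.
Proof. by move=> b c; apply: powser_ext. Qed.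
HB.instance Definition _ := GRing.isZmodMorphism.Build B K diag diag_zmod.

Lemma diag_psdeltaM f b : diag (psdelta f * b) = f * diag b.
Proof.
apply: powser_ext => n /=; rewrite -/(powser_mul _ _) -[LHS]/((psdelta f * b) n
  n).
by rewrite coef_psdeltaM; apply: eq_bigr => k _; rewrite -ltnS ltn_ord.
Qed.

Definition psz : B := powserC powserX.

Lemma coef_pszM b i j : (psz * b) i j = if j is k.+1 then b i k else 0.
Proof. by rewrite coef_psCM coef_psXM. Qed.

(** Here b is 1 / (1 - u f(uz)). Each term of u f(uz) has one more u than z, so every nonconstant
    term of the geometric series misses the diagonal. *)
Lemma diag_geometric f b : b = 1 + powserX * psdelta f * b -> diag b = 1.
Proof.
move=> bE.
have bS i j : (i <= j)%N -> b i j = ((i == 0%N) && (j == 0%N))%:R.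
  elim/ltn_ind: i j => i IH j le_ij.
  rewrite bE coef_psD -mulrA coef_psXM; case: i IH le_ij => [|i] IH le_ij.
    by rewrite coef_ps0 addr0.
  rewrite coef_psdeltaM coef_ps1 add0r big1 // => k _.
  case: leqP => // le_kj; have := ltn_ord k; rewrite ltnS => le_ki.
  rewrite IH; [|lia|lia]; rewrite (_ : (j - k == 0)%N = false) ?andbF ?mulr0 //.
  by lia.
by apply: powser_ext => n; rewrite /= bS // andbb.
Qed.

(** In the coordinates x = uz and z, these are the series without negative powers of z. *)
Definition upper b := forall i, ordge i (b i).

Lemma upperM b c : upper b -> upper c -> upper (b * c).
Proof.
move=> bU cU i; apply: ordge_sum => k _.
by rewrite -[X in ordge X](@subnKC k i) -1?ltnS //; apply: ordge_mul.
Qed.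

Lemma upperD b c : upper b -> upper c -> upper (b + c).
Proof. by move=> bU cU i j ltji; rewrite !coef_psD bU ?cU ?addr0. Qed.

(** The coefficient of u^i in b c = 1 expresses c_i through c_0 and the earlier c_j, so the support
    condition passes on by induction. *)
Lemma upper_inv b c : upper b -> b * c = 1 -> upper c.
Proof.
move=> bU bc1 i; elim/ltn_ind: i => i IH j ltji.
have bc0 : b 0%N * c 0%N = 1 by rewrite -coef_psM0 bc1.
have i_gt0 : (0 < i)%N by case: (i) ltji.
have : (b * c) i = 0 by rewrite bc1 coef_ps1 gtn_eqF.
rewrite coef_psM big_ord_recl subn0 => /(canRL (addrK _)).
rewrite sub0r => /(congr1 (fun x => c 0%N * x)).
rewrite mulrA [c 0%N * b 0%N]mulrC bc0 mul1r => ->.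
apply: (@ordge_mul _ 0 i) ltji => //.
move=> k ltki; rewrite coef_psN (ordge_sum (m := i)) ?oppr0 // => l _.
have := ltn_ord l; rewrite lift0 => ltli.
by rewrite -[X in ordge X](@subnKC l.+1 i) //; apply: ordge_mul;
  [apply: bU|apply: IH; lia].
Qed.

Lemma diag_pszM_upper b : upper b -> diag (psz * b) = 0.
Proof.
move=> bU; apply: powser_ext => n; rewrite -[LHS]/((psz * b) n n) coef_pszM.
by case: n => // n; rewrite bU.
Qed.

Definition subst_uz (T : {poly K}) : B := (map_poly psdelta T).[psz].

Fact subst_uz_zmod : zmod_morphism subst_uz.
Proof. by move=> S T; rewrite /subst_uz rmorphB hornerD hornerN. Qed.
HB.instance Definition _ := GRing.isZmodMorphism.Build {poly K} B subst_uz
  subst_uz_zmod.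

Fact subst_uz_monoid : monoid_morphism subst_uz.
Proof.
by split=> [|S T]; rewrite /subst_uz ?rmorph1 ?hornerC // rmorphM hornerM.
Qed.
HB.instance Definition _ := GRing.isMonoidMorphism.Build {poly K} B subst_uz
  subst_uz_monoid.

Lemma subst_uzC f : subst_uz f%:P = psdelta f.
Proof. by rewrite /subst_uz map_polyC hornerC. Qed.

Lemma subst_uzX : subst_uz 'X = psz.
Proof. by rewrite /subst_uz map_polyX hornerX. Qed.

Lemma coef_subst_uz (T : {poly K}) i j :
  subst_uz T i j = if (i <= j)%N then T`_(j - i) i else 0.
Proof.
elim/poly_ind: T i j => [|T f IH] i j.
  by rewrite rmorph0 coef0; case: ifP.
have -> : subst_uz (T * 'X + f%:P) = psz * subst_uz T + psdelta f.
  by rewrite rmorphD rmorphM /= subst_uzC subst_uzX mulrC.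
rewrite !coef_psD coef_pszM.
rewrite coefD coefMX coefC /=; case: j => [|j].
  by rewrite add0r leqn0; case: i => [|i] //=;
    rewrite ?mulr1n ?coef_psD ?add0r ?mulr0n.
rewrite IH; have [lt_ji|le_ij|<-] := ltngtP j.+1 i.
- by rewrite leqNgt (ltnW lt_ji) add0r mulr0n.
- by rewrite -ltnS le_ij subSn //= mulr0n !addr0.
- by rewrite ltnn subnn eqxx mulr1n.
Qed.

Lemma upper_subst_uz (T : {poly K}) : upper (subst_uz T).
Proof. by move=> i j ltji; rewrite coef_subst_uz leqNgt ltji. Qed.

End Bivariate.

(** * Furstenberg's theorem: an algebraic series as a diagonal *)

Section Furstenberg.
Variable R : comNzRingType.
Local Notation K := (powser R).
Local Notation B := (powser (powser R)).
Local Notation toK := (map_poly (@powser_of_poly R)).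

Lemma powser_of_polyXn e : powser_of_poly ('X^e) = powserX ^+ e :> K.
Proof.
rewrite rmorphXn; congr (_ ^+ e); apply: powser_ext => n.
by rewrite /= coefX.
Qed.

Lemma psdelta_shift (Z' : K) : psdelta (powserX * Z') =
  psz R * (powserX * psdelta Z').
Proof.
apply: powser_ext => i; apply: powser_ext => j.
rewrite coef_pszM [LHS]/(_ *+ _) coef_psXM.
case: i j => [|i] [|j]; rewrite ?mul0rn ?coef_psXM //.
Qed.

(** With [zeta] = Z/z and W = u (1 - zeta), the product [w * u] is 1 / (1 - Z/z), and all the other
    terms on the right carry a factor z. Those terms will have zero diagonal, as [w * (1 - zeta)] is
    the inverse of [u]. *)
Lemma furstenberg_identity (S : comNzRingType) (y x z zeta u u' w d : S) :
    u * (1 - zeta) * w = 1 ->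
  ((y + x * (z * (1 - zeta))) * (u' * (z * (1 - zeta)) + u)
     - x * (z * (u * (1 - zeta))) * d) * w =
  y * (w * u + z * (u' * (w * (1 - zeta))))
    + x * (z * (z * (1 - zeta) * (u' * (w * (1 - zeta))) + 1 - d)).
Proof.
move=> uw1; apply/eqP; rewrite -subr_eq0.
set lhs := (X in X - _); set rhs := (X in _ - X).
have -> : lhs - rhs = x * z * (1 - d) * (u * (1 - zeta) * w - 1).
  by rewrite /lhs /rhs; ring.
by rewrite uw1 subrr mulr0.
Qed.

(* In the coordinates x = uz, Q = z W with W = (1 - Z/z) U and U invertible,  *)
(* so y Q_z / Q has, up to terms without diagonal, the diagonal of            *)
(* y(Z) / (1 - Z/z), which is y(Z).                                           *)
Lemma furstenberg (Q : {poly {poly R}}) (V : {poly R}) (Z : K) (e d : nat) (c :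
  R) :
    Z 0%N = 0 -> eval_powser Q Z = 0 -> Q`_1`_0 * c = 1 ->
  exists W w : B,
    [/\ W * w = 1, psz R * W = subst_uz (toK Q)
      & diag (subst_uz (toK ((V%:P + ('X^e)%:P * 'X) * Q^`() - ('X^e)%:P * Q *+
        d)) * w)
        = powser_of_poly V + powserX ^+ e * Z].
Proof.
move=> Z0 QZ Q1.
have [U QU] : exists U, toK Q = U * ('X - Z%:P) by apply/factor_theorem/rootP.
pose Z' : K := Powser (fun n => Z n.+1).
have ZZ' : Z = powserX * Z'.
  by apply: powser_ext => n; rewrite coef_psXM; case: n.
have [zeta zetaE] : exists zeta : B, zeta = powserX * psdelta Z' by eexists.
have lin : subst_uz ('X - Z%:P) = psz R * (1 - zeta).
  rewrite rmorphB /= subst_uzX subst_uzC ZZ' psdelta_shift zetaE.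
  by rewrite mulrBr mulr1.
have [u uE] : exists u, u = subst_uz U by eexists.
have [u' u'E] : exists u', u' = subst_uz U^`() by eexists.
have zW : psz R * (u * (1 - zeta)) = subst_uz (toK Q).
  by rewrite QU rmorphM /= lin -uE mulrCA.
(* The constant term of W is the z-coefficient of Q at x = 0, a unit. Inversion then happens in
   R[[z]] and next in R[[z]][[u]]. *)
have W00 : (u * (1 - zeta)) 0%N 0%N * c = 1.
  have := coef_subst_uz (toK Q) 0 1; rewrite -zW coef_pszM => ->.
  by rewrite subn0 coef_map.
have [b Wb] := powser_inv W00.
have [w Ww] := powser_inv Wb.
exists (u * (1 - zeta)), w; split=> //.
have [xe xeE] : exists xe : K, xe = powserX ^+ e by eexists.
have [Y YE] : exists Y, Y = powser_of_poly V + xe * Z by eexists.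
(* Recentre at the root: V + x^e z = Y + x^e (z - Z), where z - Z is also the linear factor of Q. *)
have -> : toK ((V%:P + ('X^e)%:P * 'X) * Q^`() - ('X^e)%:P * Q *+ d) =
    (Y%:P + xe%:P * ('X - Z%:P)) * (U^`() * ('X - Z%:P) +
      U) - xe%:P * toK Q * d%:R.
  rewrite mulr_natr rmorphB rmorphM rmorphMn rmorphM rmorphD rmorphM /=.
  rewrite !map_polyC map_polyX /= powser_of_polyXn -xeE -deriv_map QU.
  rewrite derivM derivB derivX derivC subr0 mulr1 YE polyCD polyCM.
  by congr (_ * _ - _); rewrite mulrBr addrACA addrN addr0.
rewrite rmorphB !rmorphM /= !rmorphD !rmorphM /= lin -zW !subst_uzC -uE -u'E
  rmorph_nat.
rewrite (furstenberg_identity _ _ _ _ _ Ww) raddfD /= !diag_psdeltaM.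
have hU : upper (w * (1 - zeta)).
  apply: (@upper_inv _ u); first by rewrite uE; apply: upper_subst_uz.
  by rewrite -[RHS]Ww [w * _]mulrC mulrA.
have u'U : upper u' by rewrite u'E; apply: upper_subst_uz.
rewrite raddfD /= (@diag_geometric _ Z'); last first.
  by rewrite -zetaE -[X in _ = X + _]Ww; ring.
rewrite !diag_pszM_upper.
- by rewrite mulr0 !addr0 mulr1 YE xeE.
- apply: upperD; last by rewrite -(rmorph_nat (@subst_uz R)) -rmorphN;
  apply: upper_subst_uz.
  apply: upperD; last by rewrite -(rmorph1 (@subst_uz R));
    apply: upper_subst_uz.
  by apply: upperM; [rewrite -lin; apply: upper_subst_uz | apply: upperM].
- exact: upperM.
Qed.
End Furstenberg.

(** * States and Cartier operators *)

Section Support.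
Variable R : comNzRingType.
Local Notation B := (powser (powser R)).
Implicit Types (S T : B).

(* The support lies in a box in the exponents of x and z, where u^i z^j is    *)
(* x^i z^(j - i).                                                             *)
Definition supp a l m T :=
  forall i j, T i j != 0 -> [&& i <= a, i <= j + l & j <= i + m]%N.

Lemma supp0 a l m : supp a l m 0.
Proof. by move=> i j; rewrite /= eqxx. Qed.

Lemma suppD a l m S T : supp a l m S -> supp a l m T -> supp a l m (S + T).
Proof.
move=> Ss Ts i j; rewrite !coef_psD.
have [->|/Ss //] := eqVneq (S i j) 0.
by rewrite add0r => /Ts.
Qed.

Lemma suppN a l m T : supp a l m T -> supp a l m (- T).
Proof. by move=> Ts i j; rewrite !coef_psN oppr_eq0 => /Ts. Qed.

Lemma supp_le a l m a' l' m' T : (a <= a')%N -> (l <= l')%N -> (m <= m')%N ->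
  supp a l m T -> supp a' l' m' T.
Proof. by move=> ? ? ? Ts i j /Ts /and3P[? ? ?]; apply/and3P; split; lia. Qed.

Lemma suppM a l m a' l' m' S T : supp a l m S -> supp a' l' m' T ->
  supp (a + a') (l + l') (m + m') (S * T).
Proof.
move=> Ss Ts i j; apply: contraR => out.
rewrite coef_psM coef_ps_sum big1 // => k _; rewrite coef_psM big1 // => k' _.
have := ltn_ord k; have := ltn_ord k' => lt1 lt2.
have [->|/Ss /and3P[? ? ?]] := eqVneq (S k k') 0; first by rewrite mul0r.
have [->|/Ts /and3P[? ? ?]] := eqVneq (T (i - k)%N (j - k')%N) 0.
  by rewrite mulr0.
by case/negP: out; apply/and3P; split; lia.
Qed.

Lemma suppX a l m n T : supp a l m T -> supp (n * a) (n * l) (n * m) (T ^+ n).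
Proof.
move=> Ts; elim: n => [|n IH]; last by rewrite exprS !mulSn; apply: suppM.
move=> [|i] [|j]; rewrite expr0 coef_ps1 /= ?eqxx //.
Qed.

End Support.

Lemma inverse_perturb (S : comNzRingType) (a b e v : S) :
  a * b = 1 -> (a + e) * v = 1 -> v = b - e * b * v.
Proof.
move=> ab1 ev1; have : b * ((a + e) * v) = b by rewrite ev1 mulr1.
move=> {1}<-; transitivity (a * b * v); first by rewrite ab1 mul1r.
ring.
Qed.

(** One factor v = w^p is traded for f, the Frobenius image of w. The error gains a factor p and
    raises the total denominator exponent by one, which is the passage from level i to level i +
    1. *)
Lemma expand_identity (S : comNzRingType) (s e f v p q : S) m l :
    v = f - e * p * f * v ->
  s * v ^+ m.+1 * f ^+ l * q =
  s * v ^+ m * f ^+ l.+1 * q + (- (s * e) * v ^+ m.+1 * f ^+ l.+1 * (q * p)).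
Proof.
move=> vE; have {}vE : v + e * p * f * v - f =
  0 by rewrite [X in X + _ - _]vE subrK subrr.
apply/eqP; rewrite -subr_eq0; apply/eqP.
transitivity (s * v ^+ m * f ^+ l * q * (v + e * p * f * v - f)).
  by rewrite !exprS; ring.
by rewrite vE mulr0.
Qed.

Section States.
Variables (p alpha : nat) (R : comNzRingType).
Hypothesis p_pr : prime p.
Hypothesis R_nat : forall c : R, exists m : nat, c = m%:R.
Hypothesis p_nil : (p ^ alpha)%:R = 0 :> R.
Local Notation B := (powser (powser R)).

Variables (W w : B) (H D eps : nat).
Hypothesis Ww : W * w = 1.
Hypothesis suppW : supp H 1 D W.

Let p_gt0 : (0 < p)%N := prime_gt0 p_pr.

Lemma natmul_nil (b : B) i : (alpha <= i)%N -> b *+ p ^ i = 0.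
Proof.
move=> le_ai; apply: powser_ext => m; apply: powser_ext => n.
rewrite !coef_psMn -(subnKC le_ai) expnD mulrnA.
by rewrite -[_ *+ p ^ alpha]mulr_natr p_nil mulr0 mul0rn.
Qed.

Lemma R_fermat (c : R) : pmultiple p (c ^+ p - c).
Proof.
have [m ->] := R_nat c; rewrite -natrX.
have le_m : (m <= m ^ p)%N by case: m => [|m];
  rewrite ?leq0n // -[X in (X <= _)%N]expn1 leq_pexp2l.
rewrite -natrB //; have /dvdnP[k ->] : (p %| m ^ p - m)%N.
  by rewrite -eqn_mod_dvd //; apply/eqP/fermat_little.
by exists k%:R; rewrite natrM mulr_natr.
Qed.

Let frobz : powser R -> powser R := psfrob p idfun.
HB.instance Definition _ := GRing.isZmodMorphism.Build (powser R) (powser R)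
  frobz (psfrob_zmod p idfun).
HB.instance Definition _ := GRing.isMonoidMorphism.Build (powser R) (powser R)
  frobz (psfrob_monoid p_pr idfun).
Let frob : B -> B := psfrob p frobz.
HB.instance Definition _ := GRing.isZmodMorphism.Build B B frob (psfrob_zmod p
  frobz).
HB.instance Definition _ := GRing.isMonoidMorphism.Build B B frob
  (psfrob_monoid p_pr frobz).

(** The same residue in both variables makes this operator compatible with the diagonal. *)
Definition cartier r : B -> B := pscartier p r (pscartier p r idfun).
HB.instance Definition _ r := GRing.Additive.copy (cartier r)
  (pscartier p r (pscartier p r idfun)).

Lemma cartierM r (b c : B) : (r < p)%N -> cartier r (frob b * c) =
  b * cartier r c.
Proof.
by move=> lt_rp; apply: pscartierM => // f g; apply: pscartierM.
Qed.

Lemma frobenius_defect : exists2 E : B,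
  supp (p * H) p (p * D) E & W ^+ p = frob W + E *+ p.
Proof.
have [E0 E0E] : pmultiple p (W ^+ p - frob W).
  by apply: pmultiple_psfrob => // f; apply: pmultiple_psfrob => // c;
    apply: R_fermat.
(* R has p-torsion, so [E0] itself may be nonzero outside the box. There W^p and [frob W] both
   vanish, hence so does p [E0], and [E0] may be truncated to the box. *)
pose in_box i j := [&& i <= p * H, i <= j + p & j <= i + p * D]%N.
exists (Powser (fun i => Powser (fun j => if in_box i j then E0 i j else 0))).
  by move=> i j /=; rewrite /in_box; case: ifP => //; rewrite eqxx.
rewrite -[LHS](subrK (frob W)) addrC E0E; congr (_ + _).
apply: powser_ext => i; apply: powser_ext => j; rewrite !coef_psMn /=.
case: ifP => // out.
have := congr1 (fun x : B => x i j) E0E; rewrite !coef_psB !coef_psMn => <-.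
have -> : (W ^+ p) i j = 0.
  apply/eqP; apply: contraFT out => /(suppX (n := p) suppW).
  by rewrite muln1.
rewrite /=; case: ifP => [/dvdnP[i' iE]|_]; last by rewrite subr0 mul0rn.
rewrite /=; case: ifP => [/dvdnP[j' jE]|_]; last by rewrite subr0 mul0rn.
rewrite iE jE !mulnK //; apply/eqP; rewrite sub0r mul0rn oppr_eq0.
apply: contraFT out => /suppW /and3P[h1 h2 h3]; rewrite /in_box iE jE.
rewrite !(mulnC _ p) -[X in (_ + X)%N]muln1 -!mulnDr !leq_pmul2l //.
by apply/and3P.
Qed.

(** [eps] absorbs the extra x-degree of the initial numerator and does not grow with i. The
    z-exponents start at -i, one above the bound -(i+1) that W^(i+1) would give. *)
Definition state_box i := supp (i.+1 * H + eps) i (i.+1 * D) (R := R).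
Definition state_term i (T : B) : B := T * w ^+ i.+1 *+ p ^ i.

Definition state k (x : B) := exists2 T : nat -> B, (forall i,
  state_box i (T i)) &
  x = \sum_(k <= i < alpha) state_term i (T i).

Lemma state0 k : state k 0.
Proof.
exists (fun=> 0) => [i|]; first exact: supp0.
by rewrite big1 // => i _; rewrite /state_term mul0r mul0rn.
Qed.

Lemma stateD k x y : state k x -> state k y -> state k (x + y).
Proof.
move=> [S Sb ->] [T Tb ->]; exists (fun i => S i + T i) => [i|].
  by apply: suppD; [apply: Sb | apply: Tb].
rewrite -big_split; apply: eq_bigr => i _.
by rewrite /state_term mulrDl mulrnDl.
Qed.

Lemma state_term_state k i T : (k <= i)%N -> state_box i T ->
  state k (state_term i T).
Proof.
move=> le_ki Tb; have [le_ai|lt_ia] := leqP alpha i.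
  by rewrite /state_term natmul_nil //; apply: state0.
exists (fun j => if j == i then T else 0) => [j|].
  by case: eqP => [->|_] //; apply: supp0.
rewrite (bigD1_seq i) ?iota_uniq ?mem_index_iota ?le_ki //= eqxx.
by rewrite big1 ?addr0 // => j /negPf ->; rewrite /state_term mul0r mul0rn.
Qed.

(* Expands a negative power of W^p = frob W + p E into negative powers of     *)
(* frob W, by induction on the p-adic precision alpha - i left.               *)
Lemma state_cartier_aux r i m l S : (r < p)%N -> (m + l)%N = i.+1 ->
    supp (p * (i.+1 * H) + eps) (p * i.+1).-1 (p * (i.+1 * D)) S ->
  state 0 (cartier r (S * (w ^+ p) ^+ m * frob w ^+ l *+ p ^ i)).
Proof.
move=> lt_rp; have [E suppE WpE] := frobenius_defect.
have wp : w ^+ p = frob w - E *+ p * frob w * w ^+ p.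
  apply: (@inverse_perturb _ (frob W)); first by rewrite -rmorphM /= Ww rmorph1.
  by rewrite -WpE -exprMn Ww expr1n.
have [n] := ubnP (alpha - i); elim: n i m l S => // n IHn i m l S.
have [le_ai _ _ _|lt_ia] := leqP alpha i.
  by rewrite natmul_nil // raddf0; apply: state0.
move=> le_n; elim: m l S => [|m IHm] l S.
  rewrite add0n expr0 mulr1 => -> Sb.
  rewrite raddfMn /= -rmorphXn mulrC cartierM // mulrC.
  apply: state_term_state => // i' j' /Sb /and3P[h1 h2 h3].
  have := p_gt0 => p0.
  have e1 : (p * i' <= p * (i.+1 * H + eps))%N by nia.
  (* The bound [(p * i.+1).-1] makes this inequality strict, so that division by p yields the lower
     bound -i for the z-exponents and not -(i+1). *)
  have e2 : (p * i' < p * (j' + i.+1))%N by lia.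
  have e3 : (p * j' <= p * (i' + i.+1 * D))%N by lia.
  apply/and3P; split; last by rewrite -(leq_pmul2l p0).
    by rewrite -(leq_pmul2l p0).
  by rewrite -ltnS -addnS -(ltn_pmul2l p0).
rewrite addSn => mlE Sb.
have -> : S * (w ^+ p) ^+ m.+1 * frob w ^+ l *+ p ^ i =
    S * (w ^+ p) ^+ m * frob w ^+ l.+1 *+ p ^ i +
    (- (S * E) * (w ^+ p) ^+ m.+1 * frob w ^+ l.+1 *+ p ^ i.+1).
  rewrite expnSr -mulr_natr -[X in _ = X + _]mulr_natr -[X in _ =
    _ + X]mulr_natr natrM.
  by apply: expand_identity; rewrite [in LHS]wp mulr_natr.
rewrite raddfD /=; apply: stateD; first by apply: IHm => //; lia.
apply: IHn; [lia|lia|].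
apply: supp_le (suppN (suppM Sb suppE)); lia.
Qed.
Lemma state_cartier r x : (r < p)%N -> state 0 x -> state 0 (cartier r x).
Proof.
move=> lt_rp [T Tb ->]; rewrite raddf_sum /=.
elim/big_ind: _ => [||i _]; [exact: state0 | by move=> *; apply: stateD |].
(* Writing 1 / W^(i+1) as W^((p-1)(i+1)) / W^(p(i+1)) makes the denominator a power of W^p; the
   lower z-exponent becomes -(p(i+1) - 1). *)
have -> : state_term i (T i) = T i * W ^+ (p.-1 * i.+1) * (w ^+ p) ^+ i.+1 *+ p
  ^ i.
  rewrite /state_term -exprM -{3}(prednK p_gt0) mulSn exprD; congr (_ *+ _).
  by rewrite -[RHS]mulrA [w ^+ i.+1 * _]mulrC [X in _ =
    _ * X]mulrA -exprMn Ww expr1n mul1r.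
have -> : T i * W ^+ (p.-1 * i.+1) * (w ^+ p) ^+ i.+1 *+ p ^ i =
    T i * W ^+ (p.-1 * i.+1) * (w ^+ p) ^+ i.+1 * psfrob p (psfrob p idfun) w
      ^+ 0 *+ p ^ i.
  by rewrite expr0 mulr1.
apply: state_cartier_aux => //; first by rewrite addn0.
have pE : p = p.-1.+1 by rewrite prednK.
apply: supp_le (suppM (Tb i) (suppX (n := p.-1 * i.+1) suppW)).
- by rewrite [in X in (_ <= X)%N]pE !mulSn -mulnA; lia.
- by rewrite [in X in (_ <= X)%N]pE !mulSn; lia.
- by rewrite [in X in (_ <= X)%N]pE !mulSn -mulnA; lia.
Qed.

(** The operators are applied along the base-p digits of r, lowest digit first. *)
Lemma state_orbit i r x : state 0 x -> (r < p ^ i)%N ->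
  exists2 y, state 0 y & forall n, y n n =
    x (p ^ i * n + r)%N (p ^ i * n + r)%N.
Proof.
elim: i r x => [|i IH] r x xS.
  by rewrite ltnS leqn0 => /eqP->; exists x => // n; rewrite mul1n addn0.
rewrite expnSr => lt_r.
have [||y yS yE] := IH (r %/ p)%N (cartier (r %% p) x).
- by apply: state_cartier; rewrite ?ltn_mod.
- by rewrite ltn_divLR.
exists y => // n; rewrite yE /=.
suff -> : (p * (p ^ i * n + r %/ p) + r %% p = p ^ i * p * n + r)%N by [].
by rewrite mulnDr -addnA [(p * (r %/ p))%N]mulnC -divn_eq; congr (_ + _)%N;
  ring.
Qed.

Let box_a k := (k.+1 * H + eps).+1.
Let box_b k := (k.+1 * D + k).+1.

Lemma state_digits k : exists dig : {ffun 'I_(box_a k) * 'I_(box_b k) ->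
  'I_p} -> B,
  forall T, state_box k T -> exists g T', state_box k T' /\ T = dig g + T' *+ p.
Proof.
(* A natural number representing 0 in R may have a nonzero carry. Forcing digit and carry of 0 to
   vanish keeps both parts inside the box. *)
have /choice[dg dgP] (c : R) : exists mq : 'I_p * R,
    c = mq.1%:R + mq.2 *+ p /\ (c = 0 -> mq = (Ordinal p_gt0, 0)).
  have [->|c_neq0] := eqVneq c 0.
    by exists (Ordinal p_gt0, 0); rewrite /= mul0rn addr0.
  have [m cE] := R_nat c; have lt_p : (m %% p < p)%N by rewrite ltn_mod.
  exists (Ordinal lt_p, (m %/ p)%:R); split=> [|c0];
    last by rewrite c0 eqxx in c_neq0.
  by rewrite cE /= {1}(divn_eq m p) natrD natrM mulr_natr addrC.
exists (fun g : {ffun 'I_(box_a k) * 'I_(box_b k) ->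
  'I_p} => Powser (fun i => Powser (fun j =>
  if [&& i < box_a k, i <= j + k & j + k - i < box_b k]%N
  then (g (inord i, inord (j + k - i)) : nat)%:R else 0))).
move=> T Tb.
exists [ffun ij : 'I_(box_a k) * 'I_(box_b k) => (dg (T ij.1 (ij.1 +
  ij.2 - k)%N)).1].
exists (Powser (fun i => Powser (fun j => (dg (T i j)).2))); split.
  move=> i j /=; have [Tij0|/Tb //] := eqVneq (T i j) 0.
  by rewrite (dgP _).2 // eqxx.
apply: powser_ext => i; apply: powser_ext => j; rewrite !coef_psD !coef_psMn /=.
have [TE dg0] := dgP (T i j); rewrite [LHS]TE; congr (_ + _).
case: ifP => [/and3P[ha hk hb]|out].
  by rewrite ffunE /= !inordK // subnKC // addnK.
rewrite dg0 //; apply/eqP; apply: contraFT out => /Tb /and3P[h1 h2 h3].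
by rewrite /box_a /box_b; apply/and3P; split; lia.
Qed.

(** At level k only the digits of the numerator are kept; the carry, multiplied by W, fits the box
    of level k + 1. Each level thus contributes p to the area of its box, and only 0 remains beyond
    level alpha. *)
Lemma state_cover k : exists s : seq B,
  (size s <= p ^ (\sum_(k <= i < alpha) box_a i * box_b i))%N /\
  forall x, state k x -> x \in s.
Proof.
have [n] := ubnP (alpha - k); elim: n k => // n IH k le_n.
have [le_ak|lt_ka] := leqP alpha k.
  exists [:: 0]; rewrite big_geq //; split=> // x [T _ ->].
  by rewrite big_geq // mem_seq1.
have [s [s_size sP]] := IH k.+1 ltac:(lia).
have [dig digP] := state_digits k.
exists [seq state_term k (dig g) +
  y | g <- enum {: {ffun 'I_(box_a k) * 'I_(box_b k) -> 'I_p}}, y <- s].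
split.
  rewrite size_allpairs -cardE card_ffun card_prod !card_ord big_ltn // expnD.
  by rewrite leq_mul2l s_size orbT.
move=> x [T Tb ->]; rewrite big_ltn //.
have [g [T' [T'b ->]]] := digP _ (Tb k).
set y := \sum_(_ <= i < _) _.
have -> : state_term k (dig g + T' *+ p) + y =
    state_term k (dig g) + (state_term k.+1 (T' * W) + y).
  rewrite /state_term mulrDl mulrnDl -addrA; congr (_ + (_ + _)).
  by rewrite [w ^+ k.+2]exprS -mulrA (mulrA W) Ww mul1r mulrnAl -mulrnA -expnS.
apply: allpairs_f; first by rewrite mem_enum.
apply: sP; apply: stateD; last by exists T.
apply: state_term_state => //.
by apply: supp_le (suppM T'b suppW); rewrite ?mulSn; lia.
Qed.

End States.

Lemma size_natmul_le (A : nzRingType) (q : {poly A}) n : (size (q *+ n)%R <=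
  size q)%N.
Proof. by rewrite -scaler_nat size_scale_leq. Qed.

Lemma size_mulC_le (R : nzRingType) (V q : {poly R}) a b m :
  (size V <= a.+1)%N -> (size q <= b.+1)%N -> (a + b <= m)%N ->
    (size (V * q)%R <= m.+1)%N.
Proof. by move=> Va qb abm; apply: leq_trans (size_polyMleq _ _) _; lia. Qed.

(** * Covering the kernel by diagonals of states *)

Section KernelCover.
Variables (p alpha : nat) (R : comNzRingType).
Hypothesis p_pr : prime p.
Hypothesis R_nat : forall c : R, exists m : nat, c = m%:R.
Hypothesis p_nil : (p ^ alpha)%:R = 0 :> R.
Local Notation toK := (map_poly (@powser_of_poly R)).

Lemma kernel_cover (Q : {poly {poly R}}) (V : {poly R}) (Z : powser R) (e D H :
  nat) (c : R) :
    Z 0%N = 0 -> eval_powser Q Z = 0 -> Q`_1`_0 * c = 1 ->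
    (size V <= e.+1)%N -> (size Q <= D.+2)%N -> (forall j,
      (size (Q`_j)%R <= H.+1)%N) ->
  exists s : seq (powser (powser R)),
    (size s <= p ^ (\sum_(0 <= i < alpha) (i.+1 * H + e).+1 * (i.+1 * D +
      i).+1))%N /\
    forall i r, (r < p ^ i)%N ->
      exists2 y, y \in s & forall n, y n n =
        (powser_of_poly V + powserX ^+ e * Z) (p ^ i * n + r)%N.
Proof.
move=> Z0 QZ Q1 sizeV sizeQ sizeQY.
have [W [w [Ww zW <-]]] := furstenberg V e D.+1 Z0 QZ Q1.
set T := (_ - _ *+ _); set x := subst_uz _ * w.
have suppW : supp H 1 D W.
  move=> i j; have := coef_subst_uz (toK Q) i j.+1; rewrite -zW coef_pszM => ->.
  case: leqP => [le_ij|]; last by rewrite eqxx.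
  rewrite coef_map /= => nz; rewrite addn1 le_ij /=; apply/andP; split.
    rewrite leqNgt; apply: contra nz => lt_Hi; rewrite nth_default //.
    exact: leq_trans (sizeQY _) _.
  rewrite leqNgt; apply: contra nz => lt_j;
    rewrite [Q`_ _]nth_default ?coef0 //.
  by apply: leq_trans sizeQ _; lia.
have Tj j : T`_j = V * (Q`_j.+1 *+ j.+1) +
  'X^e * (Q`_j *+ j) - 'X^e * Q`_j *+ D.+1.
  rewrite coefB coefMn mulrDl -mulrA coefD !coefCM coefXM coef_deriv.
  by case: j => [|j] /=; rewrite ?mulr0n ?coef_deriv.
have suppT : supp (H + e) 0 D (subst_uz (toK T)).
  move=> i j; rewrite coef_subst_uz addn0.
  case: leqP => [le_ij|]; last by rewrite eqxx.
  rewrite coef_map /= Tj => nz; apply/andP; split.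
    rewrite leqNgt; apply: contra nz => lt_i; rewrite nth_default //.
    apply: leq_trans (lt_i).
    apply: leq_trans (size_polyD _ _) _; rewrite geq_max size_polyN;
      apply/andP; split.
      apply: leq_trans (size_polyD _ _) _; rewrite geq_max; apply/andP; split.
        apply: (@size_mulC_le _ _ _ e H) => //; last by rewrite addnC.
        exact: leq_trans (size_natmul_le _ _) (sizeQY _).
      apply: (@size_mulC_le _ _ _ e H); rewrite ?size_polyXn // ?(addnC H) //.
      exact: leq_trans (size_natmul_le _ _) (sizeQY _).
    apply: leq_trans (size_natmul_le _ _) _.
    by apply: (@size_mulC_le _ _ _ e H); rewrite ?size_polyXn // ?(addnC H).
  rewrite leqNgt; apply: contra nz => lt_j.
  rewrite (_ : V * _ = 0) ?add0r; last first.
    by rewrite [Q`_ _]nth_default ?mul0rn ?mulr0 //; apply: leq_trans sizeQ _;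
      lia.
  (* In z-degree D + 1 the contributions of x^e z Q_z and (D + 1) x^e Q cancel, which brings the
     numerator down to degree D. *)
  have [->|neq_j] := eqVneq (j - i)%N D.+1;
    first by rewrite mulrnAr subrr coef0.
  rewrite [Q`_ _]nth_default ?mul0rn ?mulr0 ?mul0rn ?subrr ?coef0 //.
  by apply: leq_trans sizeQ _; move: neq_j; lia.
have xS : state p alpha w H D e 0 x.
  have := @state_term_state p alpha R p_nil w H D e 0 0 (subst_uz (toK T)) isT.
  by rewrite /state_term mulr1n expr1; apply; rewrite /state_box !mul1n.
have [s [s_size sP]] := state_cover p_pr R_nat p_nil e Ww suppW 0.
exists s; split=> // i r lt_r.
have [y yS yE] := state_orbit p_pr R_nat p_nil Ww suppW xS lt_r.
by exists y; [apply: sP | ].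
Qed.
End KernelCover.

(** * Reduction to Z/p^alpha *)

Section XDegree.
Variable A : comNzRingType.
Implicit Types S T : {poly {poly A}}.

Definition degx_le m T := forall j, (size (T`_j)%R <= m.+1)%N.

Lemma degx_le_sum m I (r : seq I) (F : I -> {poly {poly A}}) :
  (forall i, degx_le m (F i)) -> degx_le m (\sum_(i <- r) F i).
Proof.
move=> Fm; elim/big_ind: _ => [j|S T Sm Tm j|i _]; last exact: Fm.
  by rewrite coef0 size_poly0.
by rewrite coefD (leq_trans (size_polyD _ _)) // geq_max Sm Tm.
Qed.

Lemma degx_leM m n S T : degx_le m S -> degx_le n T -> degx_le (m + n) (S * T).
Proof.
move=> Sm Tn j; rewrite coefM; apply: leq_trans (size_sum _ _ _) _.
by apply/bigmax_leqP => i _; apply: (size_mulC_le (Sm _) (Tn _)).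
Qed.

Lemma degx_leC m (q : {poly A}) : (size q <= m.+1)%N -> degx_le m q%:P.
Proof. by move=> qm j; rewrite coefC; case: eqP; rewrite ?size_poly0. Qed.

Lemma degx_leX m n T : degx_le m T -> degx_le (n * m) (T ^+ n).
Proof.
move=> Tm; elim: n => [|n IH]; first by apply: degx_leC; rewrite size_poly1.
by rewrite exprS mulSn; apply: degx_leM.
Qed.

Lemma degx_le_comp h d m S T : degx_le h S -> (size S <= d.+1)%N ->
  degx_le m T ->
  degx_le (h + d * m) (S \Po T).
Proof.
move=> Sh Sd Tm; rewrite comp_polyE; apply: degx_le_sum => i j.
rewrite -mul_polyC; have := degx_leM (degx_leC (Sh i)) (degx_leX i Tm) j.
move=> /leq_trans; apply; rewrite ltnS leq_add2l leq_mul2r -ltnS.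
by rewrite (leq_trans (ltn_ord i)) ?orbT.
Qed.

Lemma mulXn_eq0 n (q : {poly A}) : 'X^n * q = 0 -> q = 0.
Proof.
move=> q0; apply/polyP => i; rewrite coef0.
by have := congr1 (fun q : {poly A} => q`_(i + n)) q0;
  rewrite coefXnM ltnNge leq_addl addnK coef0.
Qed.

End XDegree.

Section PsMap.
Variables (A A' : comNzRingType) (f : {rmorphism A -> A'}).

Definition psmap (g : powser A) : powser A' := Powser (fun n => f (g n)).

Fact psmap_zmod : zmod_morphism psmap.
Proof. by move=> g h; apply: powser_ext => n; rewrite /= rmorphB. Qed.
HB.instance Definition _ := GRing.isZmodMorphism.Build (powser A) (powser A')
  psmap psmap_zmod.

Fact psmap_monoid : monoid_morphism psmap.
Proof.
split=> [|g h]; apply: powser_ext => n; first by rewrite /= rmorph_nat.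
by rewrite /= rmorph_sum; apply: eq_bigr => i _; rewrite rmorphM.
Qed.
HB.instance Definition _ := GRing.isMonoidMorphism.Build (powser A) (powser A')
  psmap psmap_monoid.

Lemma eval_powser_map (P : {poly {poly A}}) (g : powser A) :
  eval_powser (map_poly (map_poly f) P) (psmap g) = psmap (eval_powser P g).
Proof.
rewrite /eval_powser -horner_map -!map_poly_comp /=; congr horner.
by apply: eq_map_poly => q; apply: powser_ext => n; rewrite /= coef_map.
Qed.

End PsMap.

Section Padic.
Variable p : nat.
Hypothesis p_pr : prime p.

Definition padic_level a (x : padic_int p) : 'Z_(p ^ a.+1) := x a.

Fact padic_level_zmod a : zmod_morphism (padic_level a).
Proof. by []. Qed.
HB.instance Definition _ a := GRing.isZmodMorphism.Build (padic_int p) _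
  (padic_level a) (padic_level_zmod a).
Fact padic_level_monoid a : monoid_morphism (padic_level a).
Proof. by []. Qed.
HB.instance Definition _ a := GRing.isMonoidMorphism.Build (padic_int p) _
  (padic_level a) (padic_level_monoid a).

Lemma padic_modS a x : padic_mod a.+1 x = padic_level a x.
Proof. by rewrite /padic_mod natr_Zp. Qed.

Lemma expp_gt1 a : (1 < p ^ a.+1)%N.
Proof. by rewrite -(exp1n a.+1) ltn_exp2r // prime_gt1. Qed.

Lemma padic_level_eqmod (x : padic_int p) a : (x a = x 0%N %[mod p])%N.
Proof.
elim: a => // a <-; have := congr1 (@nat_of_ord _) (padic_resP x a).
rewrite /Zp_restr Zp_nat /= [X in (_ %% X)%N = _](Zp_cast (expp_gt1 a)) => <-.
by rewrite modn_dvdm // dvdn_exp.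
Qed.

(** All residues of x agree modulo p, so a nonzero residue modulo p makes each of them prime to
    p. *)
Lemma padic_level_unit (x : padic_int p) a :
  padic_mod 1 x != 0 -> exists c, padic_level a x * c = 1.
Proof.
rewrite padic_modS => x0; exists (padic_level a x)^-1; rewrite divrr //.
rewrite -[padic_level a x]natr_Zp unitZpE ?expp_gt1 // coprimeXl //
  prime_coprime //.
rewrite /dvdn padic_level_eqmod -/(dvdn _ _); apply: contra x0 => p_x0.
have [k x0E] := dvdnP p_x0; rewrite -[padic_level 0 x]natr_Zp /padic_level x0E
  natrM.
have natr_exp1 (S : nzRingType) : p%:R = (p ^ 1)%:R :> S by rewrite expn1.
by rewrite natr_exp1 pchar_Zp ?expp_gt1 // mulr0.
Qed.

(** Substituting V + x^e z raises the x-degree to at most h + d e, and dividing by x^s lowers it by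
    s. The relations then reduce coefficientwise to Z/p^alpha. *)
Lemma padic_kernel_cover alpha h d (P : {poly {poly padic_int p}})
    (F : powser (padic_int p)) e s (Q : {poly {poly padic_int p}}) :
    (0 < alpha)%N -> (0 < d)%N -> degx_le h P -> (size P <= d.+1)%N ->
    eval_powser P F = 0 -> shifted_poly P F e = ('X^s)%:P * Q ->
    padic_mod 1 Q^`().[0, 0] != 0 ->
  exists S : seq (powser (powser 'Z_(p ^ alpha))),
    (size S <= p ^ (\sum_(0 <= i < alpha)
       (i.+1 * (h + d * e - s) + e).+1 * (i.+1 * d.-1 + i).+1))%N /\
    forall i r, (r < p ^ i)%N -> exists2 y, y \in S &
      forall n, y n n = padic_mod alpha (F (p ^ i * n + r)%N).
Proof.
case: alpha => // a _ d_gt0 Ph Pd PF PeE Qu.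
pose V : {poly padic_int p} := \poly_(n < e.+1) F n.
(* V already contains the coefficient at e, so F = V + x^e Z with zero constant term in Z. *)
pose Z : powser (padic_int p) := Powser (fun n => if n == 0%N then 0 else F (n
  + e)%N).
have FE : F = powser_of_poly V + powserX ^+ e * Z.
  apply: powser_ext => n; rewrite coef_psD coef_psXnM /= coef_poly ltnS
    subn_eq0.
  by case: ltngtP => [lt_ne|lt_en|->]; rewrite ?addr0 ?add0r // subnK // ltnW.
pose G : {poly {poly padic_int p}} := V%:P + ('X^e)%:P * 'X.
have PGE : P \Po G = ('X^s)%:P * Q := PeE.
have QZ : eval_powser Q Z = 0.
  have : eval_powser (P \Po G) Z = 0.
    rewrite /eval_powser map_comp_poly horner_comp.
    rewrite [map_poly _ G]rmorphD rmorphM /= !map_polyC map_polyX /=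
      powser_of_polyXn.
    by rewrite hornerD hornerM !hornerC hornerX -FE.
  rewrite PGE /eval_powser rmorphM hornerM /= map_polyC hornerC /=
    powser_of_polyXn => XQ.
  apply: powser_ext => n; have := congr1 (fun f : powser (padic_int p) => f (n
    + s)%N) XQ.
  by rewrite coef_psXnM leq_addl addnK.
have Gd : degx_le e G.
  move=> j; rewrite coefD coefC coefCM coefX; case: j => [|[|j]] /=.
  - by rewrite mulr0 addr0 size_poly.
  - by rewrite mulr1 add0r size_polyXn.
  - by rewrite mulr0 addr0 size_poly0.
have Qd j : (size (Q`_j)%R <= (h + d * e - s).+1)%N.
  have := degx_le_comp Ph Pd Gd j; rewrite PGE coefCM.
  have [->|Qj0] := eqVneq Q`_j 0; first by rewrite size_poly0.
  rewrite mulrC size_mulXn //; move: Qj0; rewrite -size_poly_gt0;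
    by move: (size _) => z; lia.
have sizeQ : (size Q <= d.+1)%N.
  apply/leq_sizeP => j le_dj; apply: (@mulXn_eq0 _ s).
  rewrite -coefCM -PGE nth_default //; apply: leq_trans le_dj.
  apply: leq_trans (size_comp_poly_leq _ _) _; rewrite ltnS.
  have sizeG : (size G <= 2)%N.
    apply: leq_trans (size_polyD _ _) _; rewrite geq_max; apply/andP; split.
      by apply: leq_trans (size_polyC_leq1 _) _.
    apply: leq_trans (size_polyMleq _ _) _; rewrite size_polyX addn2.
    exact: size_polyC_leq1.
  by case: (size P) Pd => [|k]; case: (size G) sizeG => [|[|[|l]]] //=; lia.
pose f := padic_level a.
have [c fc] : exists c, f Q`_1`_0 * c = 1.
  by apply: padic_level_unit; move: Qu; rewrite !horner_coef0 coef_deriv.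
have [||||||||S [S_size SP]] := @kernel_cover p a.+1 'Z_(p ^ a.+1) p_pr _ _
    (map_poly (map_poly f) Q) (map_poly f V) (psmap f Z) e d.-1 (h +
      d * e - s) c.
- by move=> x; exists x; rewrite natr_Zp.
- exact: pchar_Zp (expp_gt1 a).
- by [].
- by rewrite eval_powser_map QZ rmorph0.
- by rewrite !coef_map.
- by apply: leq_trans (size_poly _ _) _; apply: size_poly.
- by apply: leq_trans (size_poly _ _) _; rewrite prednK.
- by move=> j; rewrite coef_map; apply: leq_trans (size_poly _ _) _; apply: Qd.
exists S; split=> // i r lt_r; have [y yS yE] := SP i r lt_r.
exists y => // n; rewrite yE padic_modS [in RHS]FE [in RHS]coef_psD
  [LHS]coef_psD.
rewrite (raddfD (padic_level a)) !coef_psXnM; congr (_ + _);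
  first exact: coef_map.
by case: ifP => // _; rewrite raddf0.
Qed.
End Padic.

(** * The order of the discriminant and the final count *)

Lemma size_det_le (A : comNzRingType) n h (M : 'M[{poly A}]_n) :
  (forall i j, size (M i j) <= h.+1)%N -> (size (\det M) <= (n * h).+1)%N.
Proof.
move=> Mh; rewrite /determinant; elim/big_ind: _ => [|q r hq hr|s _].
- by rewrite size_poly0.
- by rewrite (leq_trans (size_polyD _ _)) // geq_max hq hr.
rewrite -signr_odd; set P := \prod_i _.
suff hP : (size P <= (n * h).+1)%N.
  by case: odd; rewrite ?expr1 ?expr0 ?mulN1r ?size_polyN ?mul1r.
apply: leq_trans (size_poly_prod_leq _ _) _; rewrite leq_subLR addnS ltnS.
rewrite card_ord -mulnS -[X in (_ <= X * _)%N]card_ord -sum_nat_const.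
by apply: leq_sum => i _; apply: Mh.
Qed.

Lemma mindeg_le (A : nzRingType) (q : {poly A}) n : (size q <= n.+1)%N ->
  (mindeg q <= n)%N.
Proof.
move=> qn; have [q0|q_neq0] := eqVneq q 0; first by rewrite /mindeg q0 polyseq0.
apply: (@leq_trans (size q).-1); last by case: (size q) qn.
rewrite leqNgt; apply: contra q_neq0 => /(before_find 0) /negbFE.
by rewrite -lead_coefE lead_coef_eq0.
Qed.

(** The Sylvester matrix has at most d + (d - 1) rows, with entries of x-degree at most h. Over a
    general ring the derivative may lose degree, so its size is only bounded above. *)
Lemma mindeg_discr_le (A : comNzRingType) (P : {poly {poly A}}) h d :
  degx_le h P -> (size P <= d.+1)%N ->
  (mindeg (resultant P P^`()) <= (d + d.-1) * h)%N.
Proof.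
move=> Ph Pd; apply: mindeg_le; rewrite /resultant.
have P'd : (size P^`() <= d)%N.
  apply: leq_trans (size_poly _ _) _; by case: (size P) Pd.
have dim : ((size P^`()).-1 + (size P).-1 <= d + d.-1)%N by lia.
apply: leq_trans (_ : ((size P^`()).-1 + (size P).-1) * h < _)%N;
  last by rewrite ltnS leq_mul2r dim orbT.
apply: size_det_le => i j; rewrite Sylvester_mxE.
case: (fintype.split i) => k; apply: leq_trans (size_natmul_le _ _) _.
  exact: Ph.
by rewrite coef_deriv; apply: leq_trans (size_natmul_le _ _) (Ph _).
Qed.

(** Differentiating P(x, V + x^e z) = x^e Q in z produces x^e on both sides; cancel it and set z = x
    = 0. *)
Lemma shifted_deriv00 (A : comNzRingType) (P Q : {poly {poly A}}) (F : powser
  A) e :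
  shifted_poly P F e = ('X^e)%:P * Q ->
  Q^`().[0, 0] = (map_poly (horner_eval (0 : A)) P^`()).[F 0%N].
Proof.
rewrite /shifted_poly; set V := \poly_(_ < _) _; set G := _ + _ => PGE.
have : Q^`() = P^`() \Po G.
  apply/eqP; rewrite -subr_eq0; apply/eqP/polyP => j; rewrite coef0.
  apply: (@mulXn_eq0 _ e); rewrite -coefCM mulrBr coefB.
  have := congr1 (fun T : {poly {poly A}} => T^`()) PGE; rewrite deriv_comp.
  have -> : G^`() = ('X^e)%:P by rewrite derivD derivC add0r derivM derivC
    mul0r add0r derivX mulr1.
  by rewrite derivM derivC mul0r add0r mulrC => ->; rewrite subrr.
move=> ->; rewrite horner_comp.
have -> : G.[0%:P] = V by rewrite hornerD hornerM !hornerC hornerX mulr0 addr0.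
rewrite -[LHS]/(horner_eval 0 _) -horner_map /= /horner_eval.
by rewrite horner_coef0 coef_poly.
Qed.

Lemma pkernel_card_le (T : choiceType) p (b : nat -> T) (s : seq (nat -> T)) :
    (0 < p)%N ->
    (forall i r, (r < p ^ i)%N -> (fun n => b (p ^ i * n + r)%N) \in s) ->
  finite_set (pkernel p b) /\ (#|` fset_set (pkernel p b)| <= size s)%N.
Proof.
move=> p_gt0 b_s.
have sub : pkernel p b `<=` [set` s].
  move=> _ [i [r [le_r ->]]]; apply: b_s.
  by have := expn_gt0 p i; rewrite p_gt0 /=; lia.
have fin : finite_set (pkernel p b) := sub_finite_set sub (finite_seq s).
split=> //; apply: (@leq_trans #|` [fset x in s]%fset|).
  apply/fsubset_leq_card/fsubsetP => x; rewrite in_fset_set // inE => /sub.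
  by rewrite !inE.
by rewrite card_fseq size_undup.
Qed.

(** The second side of each box is (i + 1)(d' + 1), so only sums of integers and of squares
    occur. *)
Lemma sum_boxes h' e d' alpha :
  (6 * (\sum_(0 <= i < alpha) (i.+1 * h' + e).+1 * (i.+1 * d' + i).+1) =
   alpha * alpha.+1 * (d'.+1 * (h' * (2 * alpha + 1) + 3 * e.+1)))%N.
Proof.
elim: alpha => [|a IH]; first by rewrite big_geq.
by rewrite big_nat_recr //= mulnDr IH; lia.
Qed.

(** The term -alpha of the target exponent is moved to the left to stay in the naturals. With d = d'
    + 1, what remains is alpha - 1 <= 2 (alpha - 1) d (e + 1). *)
Lemma sum_boxes_le h' e d' D alpha : (0 < alpha)%N ->
    (d'.+1 * (h' + e.+1) <= D)%N ->
  (6 * (\sum_(0 <= i < alpha) (i.+1 * h' + e).+1 * (i.+1 * d' + i).+1)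
    + alpha * alpha.+1 * alpha <= alpha * alpha.+1 * (2 * alpha * D + D + 1))%N.
Proof.
move=> a_gt0 D_ge; rewrite sum_boxes -mulnDr leq_mul2l; apply/orP; right.
case: alpha a_gt0 => // a _; nia.
Qed.

(** Choosing [eta] before P and F expresses the uniformity of the asymptotic bound. *)
Theorem theorem51 (R : realType) :
  exists eta : nat -> nat -> nat -> nat -> R,
  [/\ forall (p alpha h d : nat) (P : {poly {poly padic_int p}})
        (F : powser (padic_int p)) (s : nat) (Q : {poly {poly padic_int p}}),
      prime p -> (1 <= alpha)%N -> (1 <= h)%N -> (1 <= d)%N ->
      squarefree P -> sizeY P = h.+1 -> size P = d.+1 ->
      eval_powser P F = 0 ->
      let e := mindeg (resultant P P^`()) in
      let Pe := shifted_poly P F e in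
      (e <= s <= 2 * e)%N ->
      Pe = ('X^s)%:P * Q ->
      Q^`().[0, 0] != 0 ->
      padic_mod 1 Q^`().[0, 0] != 0 ->
      sizeY Pe = sizeY (polyXY_modp Pe) ->
      size Pe = size (polyXY_modp Pe) ->
      let a_mod := fun n => padic_mod alpha (F n) in
      let D : R := h%:R * d%:R * (2 * d%:R ^+ 2 - d%:R + 1) in
      finite_set (pkernel p a_mod) /\
      (#|` fset_set (pkernel p a_mod)|%fset%:R : R) <=
        (1 + eta p alpha h d) *
        p%:R `^ (6^-1 * alpha%:R * (alpha%:R + 1) *
                 ((2 * D - 1) * alpha%:R + D + 1)),
      forall alpha h d : nat, (1 <= alpha)%N -> (1 <= h)%N -> (1 <= d)%N ->
        eta p alpha h d @[p --> \oo] --> (0 : R),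
      forall p h d : nat, prime p -> (1 <= h)%N -> (1 <= d)%N ->
        eta p alpha h d @[alpha --> \oo] --> (0 : R),
      forall p alpha d : nat, prime p -> (1 <= alpha)%N -> (1 <= d)%N ->
        eta p alpha h d @[h --> \oo] --> (0 : R) &
      forall p alpha h : nat, prime p -> (1 <= alpha)%N -> (1 <= h)%N ->
        eta p alpha h d @[d --> \oo] --> (0 : R)].
Proof.
exists (fun _ _ _ _ => 0); split; try by move=> *; apply: cvg_cst.
move=> p alpha h d P F s Q p_pr alpha_gt0 h_gt0 d_gt0 _ hP dP PF e Pe.
move=> /andP[le_es _] PeE _ Qu _ _ a_mod D; rewrite addr0 mul1r.
have Ph : degx_le h P by move=> j; rewrite -hP max_size_coefXY.
have Pd : (size P <= d.+1)%N by rewrite dP.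
have le_e : (e <= (d + d.-1) * h)%N := mindeg_discr_le Ph Pd.
(* The pair (e', s') is (e, s) if s > e, and (0, 0) if s = e. The inequality is the hypothesis of
   [sum_boxes_le], with right side equal to [D]. *)
have [e' [s' [Q' [PeE' Qu' bound]]]] : exists e' s' Q',
    [/\ shifted_poly P F e' = ('X^s')%:P * Q', padic_mod 1 Q'^`().[0, 0] != 0
      & (d * (h + d * e' - s' + e'.+1) <= d * (h + d * ((d + d.-1) * h)))%N].
  have [lt_es|le_se] := ltnP e s.
    exists e, s, Q; split=> //; rewrite leq_mul2l; apply/orP; right.
    have : (d * e <= d * ((d + d.-1) * h))%N by rewrite leq_mul2l le_e orbT.
    (* This covers the case where the subtraction in [h + d * e - s] truncates to 0. *)
    have : (e <= d * ((d + d.-1) * h))%N.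
      by apply: leq_trans le_e _; rewrite leq_pmull.
    by move: (d * (_ * _))%N (d * e)%N; lia.
  have es : s = e by apply/eqP; rewrite eqn_leq le_se le_es.
  (* With e' = 0 the polynomial is P(x, a(0) + z); its z-derivative at the origin is P_y(0, a(0)),
     equal to that of Q. *)
  exists 0%N, 0%N, (shifted_poly P F 0); split; first by rewrite expr0 mul1r.
    rewrite (@shifted_deriv00 _ P _ F 0) ?expr0 ?mul1r //.
    by rewrite -(@shifted_deriv00 _ P Q F e) // -[in RHS]es.
  rewrite muln0 addn0 subn0 leq_mul2l leq_add2l !muln_gt0; apply/orP; right.
  by rewrite d_gt0 h_gt0 addn_gt0 d_gt0.
have [S [S_size SP]] := padic_kernel_cover p_pr alpha_gt0 d_gt0 Ph Pd PF PeE'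
  Qu'.
have [||fin card] := @pkernel_card_le _ p a_mod [seq (fun n => y n n) | y :
  powser (powser 'Z_(p ^ alpha)) <- S].
- exact: prime_gt0.
- move=> i r lt_r; have [y yS yE] := SP i r lt_r.
  by apply/mapP; exists y => //; apply: funext => n; rewrite yE.
split=> //; set N := (\sum_(_ <= _ < _) _)%N in S_size.
apply: (@le_trans _ _ (p%:R `^ N%:R)).
  by rewrite powR_mulrn // -natrX ler_nat (leq_trans card) // size_map.
apply: ler_powR; first by rewrite ler1n prime_gt0.
have DE : D = (d * (h + d * ((d + d.-1) * h)))%:R.
  rewrite /D; case: (d) d_gt0 => // d' _ /=.
  by rewrite !(natrM, natrD) -[d'.+1]addn1 natrD; ring.
move: (d * (h + d * ((d + d.-1) * h)))%N DE bound => Dn DE bound.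
have := @sum_boxes_le (h + d * e' - s') e' d.-1 Dn alpha alpha_gt0.
rewrite prednK // => /(_ bound); rewrite -/N -(ler_nat R) !(natrM, natrD) -DE.
rewrite -[alpha.+1]addn1 natrD => le_N.
lra.
Qed.
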